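(* Let $\tilde\rho$ be a coherent risk measure with support set $\mathcal C$, and consider the inverse problem $$\inf_{\rho,\ \epsilon\in\mathbb R}\ \epsilon\quad\text{s.t.}\quad \rho\in\mathcal R,\quad \|\rho-\tilde\rho\|_\infty\le\epsilon,\quad \rho(\vec W^{t})\le\rho(\vec W)\ \ \forall\,\vec W\in\mathcal W^{t},\ t\in\mathcal T,\quad \rho(\vec L_k)\le\rho(\vec U_k)\ \ \forall k\in\mathcal K .$$ Assume that its set of optimal solutions is non-empty. Then there exists a function $\rho_\delta\in\mathcal L(\{\vec X_j\}_{j\in\mathcal J},\mathcal C)$ that is optimal to the inverse problem. Moreover, given any optimal solution $\rho_0$ of the inverse problem, there exists a function $\rho_\delta\in\mathcal L(\{\vec X_j\}_{j\in\mathcal J},\mathcal C)$ that is also optimal and satisfies $$\rho_\delta(\vec Z)\ge\rho_0(\vec Z)\qquad\forall\,\vec Z\in\mathbb R^{|\Omega|},$$ namely the one obtained by setting $\delta_j=\rho_0(\vec X_j)$ for all $j\in\mathcal J$.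
   Context: $\Omega=\{\omega_i\}_{i=1}^M$ is a finite sample space; a random loss is identified with a vector $\vec Z\in\mathbb R^{|\Omega|}$, and for a scalar $c$, $\vec Z+c$ means adding $c$ to each entry. $\mathcal R$ is the set of functions $\rho:\mathbb R^{|\Omega|}\to\mathbb R$ with $\rho(\vec 0)=0$ that are monotone ($\vec Z_1\le\vec Z_2$ entrywise implies $\rho(\vec Z_1)\le\rho(\vec Z_2)$), convex, and translation invariant ($\rho(\vec Z+c)=\rho(\vec Z)+c$). A coherent risk measure is a $\rho\in\mathcal R$ with $\rho(\lambda\vec Z)=\lambda\rho(\vec Z)$ for all $\lambda\ge0$; it can be written $\rho(\vec Z)=\sup_{p\in\mathcal C}p^\top\vec Z$ for a non-empty closed convex set $\mathcal C\subseteq\Delta:=\{p\in\mathbb R^{|\Omega|}: \vec 1^\top p=1,\ p\ge0\}$, called its support set. Data: $\mathcal T$ and $\mathcal K$ are finite index sets. For $t\in\mathcal T$, an observation consists of a convex set $\mathcal X^t\subseteq\mathbb R^n$, a map $\vec Z^t(\cdot)$ into $\mathbb R^{|\Omega|}$ whose entries are convex functions of $x$, and a point $x^t\in\mathcal X^t$; $\vec W^t:=\vec Z^t(x^t)$ and $\mathcal W^t:=\{\vec Z^t(x): x\in\mathcal X^t\}$. For $k\in\mathcal K$, $(\vec L_k,\vec U_k)$ is a pair of random losses. $\{\vec X_j\}_{j\in\mathcal J}$ is the finite family consisting of all $\vec W^t$ ($t\in\mathcal T$), $\vec L_k,\vec U_k$ ($k\in\mathcal K$), and $\vec 0$. $\|\cdot\|_\infty$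 is the supremum norm over functions on $\mathbb R^{|\Omega|}$. For a finite family $\{\vec Z_j\}_{j\in\bar{\mathcal J}}$ and $\bar{\mathcal C}\subseteq\Delta$, $\mathcal L(\{\vec Z_j\}_{j\in\bar{\mathcal J}},\bar{\mathcal C})$ is the set of all functions of the form $$\rho_\delta(\vec Z)=\sup_{p\in\bar{\mathcal C}}\Big\{p^\top\vec Z-\max_{j\in\bar{\mathcal J}}\{p^\top\vec Z_j-\delta_j\}\Big\},\qquad \delta\in\mathbb R^{|\bar{\mathcal J}|}.$$ *)

(* Defs.v *)
From HB Require Import structures.
From mathcomp Require Export all_boot all_order all_algebra.
From mathcomp Require Export all_classical all_reals all_analysis.
Export Order.TTheory GRing.Theory Num.Theory.
Export numFieldNormedType.Exports.

Set Implicit Arguments.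
Unset Strict Implicit.
Unset Printing Implicit Defensive.

Local Open Scope classical_set_scope.
Local Open Scope ring_scope.

(* A random loss on a sample space with M outcomes is a column vector in
   'cV[R]_M; its i-th entry is its value at the i-th outcome. *)

Definition pair_dot (R : realType) (M : nat) (p Z : 'cV[R]_M) : R :=
  (p^T *m Z) 0 0.

(* Extended-real valued: +oo on unbounded functions. *)
Definition sup_norm (R : realType) (M : nat) (f : 'cV[R]_M -> R) : \bar R :=
  ereal_sup [set `|f Z|%:E | Z in [set: 'cV[R]_M]].

Definition risk_function (R : realType) (M : nat) : set ('cV[R]_M -> R) :=
  [set rho | [/\ rho 0 = 0,
    forall Z1 Z2 : 'cV[R]_M, (forall i, Z1 i 0 <= Z2 i 0) -> rho Z1 <= rho Z2,
    convex_function [set: 'cV[R]_M] rho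
    & forall (Z : 'cV[R]_M) (c : R), rho (Z + const_mx c) = rho Z + c]].

Definition coherent (R : realType) (M : nat) (rho : 'cV[R]_M -> R) : Prop :=
  risk_function rho /\
  forall (l : R) (Z : 'cV[R]_M), 0 <= l -> rho (l *: Z) = l * rho Z.

Definition simplex (R : realType) (M : nat) : set 'cV[R]_M :=
  [set p | \sum_i p i 0 = 1 /\ forall i, 0 <= p i 0].

Definition support_set (R : realType) (M : nat) (rho : 'cV[R]_M -> R)
    (C : set 'cV[R]_M) : Prop :=
  [/\ C !=set0, closed C, convex_set C, C `<=` @simplex R M
    & forall Z, (rho Z)%:E = ereal_sup [set (pair_dot p Z)%:E | p in C]].

(* The supremum and the maximum are taken in the extended reals, so that no
   default value intervenes when one of them is infinite. *)
Definition rho_delta (R : realType) (M : nat) (J : finType)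
    (Zs : J -> 'cV[R]_M) (C : set 'cV[R]_M) (delta : J -> R)
    (Z : 'cV[R]_M) : \bar R :=
  ereal_sup [set ((pair_dot p Z)%:E
     - \big[maxe/-oo]_(j : J) (pair_dot p (Zs j) - delta j)%:E)%E | p in C].

Definition rho_delta_family (R : realType) (M : nat) (J : finType)
    (Zs : J -> 'cV[R]_M) (C : set 'cV[R]_M) : set ('cV[R]_M -> R) :=
  [set rho | exists delta : J -> R,
     forall Z, (rho Z)%:E = rho_delta Zs C delta Z].

Definition data_losses (R : realType) (M : nat) (T K : finType)
    (W : T -> 'cV[R]_M) (L U : K -> 'cV[R]_M)
    (j : option (T + (K + K))%type) : 'cV[R]_M :=
  match j with
  | None => 0
  | Some (inl t) => W t
  | Some (inr (inl k)) => L k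
  | Some (inr (inr k)) => U k
  end.

Section InverseProblem.
Variables (R : realType) (M n : nat) (T K : finType).
Variable rhot : 'cV[R]_M -> R.
Variables (X : T -> set 'cV[R]_n) (Z : T -> 'cV[R]_n -> 'cV[R]_M).
Variables (x : T -> 'cV[R]_n) (L U : K -> 'cV[R]_M).

Definition inverse_feasible (rho : 'cV[R]_M -> R) (eps : R) : Prop :=
  [/\ risk_function rho,
      (sup_norm (fun V => rho V - rhot V)%R <= eps%:E)%E,
      forall t W, (Z t @` X t) W -> rho (Z t (x t)) <= rho W
    & forall k, rho (L k) <= rho (U k)].

Definition inverse_optimal (rho : 'cV[R]_M -> R) : Prop :=
  exists eps : R, inverse_feasible rho eps /\
    forall rho' eps', inverse_feasible rho' eps' -> eps <= eps'.

End InverseProblem.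

(* Main.v *)
(* Every subgradient p of rho_0 satisfies p.Y <= rhot Y, because rho_0 stays
   within a bounded distance of the positively homogeneous rhot; separating p
   from C by the nearest point of C gives p in C.  Hence the supremum over C of
   p.V - max_j (p.X_j - rho_0(X_j)) is at least rho_0(V), by taking p a
   subgradient at V, and it equals rho_0 at each X_j, by discarding all but the
   j-th term of the max.  Since 0 is one of the X_j it is also at most rhot, so
   passing from rho_0 to this function keeps the distance to rhot and all the
   preference constraints. *)
Require Import Defs.
From mathcomp Require Import ring lra.

Set Implicit Arguments.
Unset Strict Implicit.
Unset Printing Implicit Defensive.

Local Open Scope classical_set_scope.
Local Open Scope ring_scope.

(** * The pairing as a scalar product, and as an expectation on the simplex *)

Section PairDot.
Variables (R : realType) (M : nat).
Implicit Types (p q Y Z : 'cV[R]_M) (c : R).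

Lemma pair_dotE p Y : pair_dot p Y = \sum_i p i 0 * Y i 0.
Proof. by rewrite /pair_dot mxE; apply: eq_bigr => i _; rewrite mxE. Qed.

Lemma pair_dotDr p Y Z : pair_dot p (Y + Z) = pair_dot p Y + pair_dot p Z.
Proof. by rewrite /pair_dot mulmxDr mxE. Qed.

Lemma pair_dotZr p c Y : pair_dot p (c *: Y) = c * pair_dot p Y.
Proof. by rewrite /pair_dot -scalemxAr mxE. Qed.

Lemma pair_dot0r p : pair_dot p 0 = 0.
Proof. by rewrite /pair_dot mulmx0 mxE. Qed.

Lemma pair_dotBr p Y Z : pair_dot p (Y - Z) = pair_dot p Y - pair_dot p Z.
Proof. by rewrite pair_dotDr -scaleN1r pair_dotZr mulN1r. Qed.

Lemma pair_dotBl p q Y : pair_dot (p - q) Y = pair_dot p Y - pair_dot q Y.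
Proof.
by rewrite !pair_dotE -sumrB; apply: eq_bigr => i _; rewrite !mxE mulrBl.
Qed.

Lemma pair_dotC p Y : pair_dot p Y = pair_dot Y p.
Proof. by rewrite !pair_dotE; apply: eq_bigr => i _; rewrite mulrC. Qed.

Lemma pair_dot_ge0 p : 0 <= pair_dot p p.
Proof. by rewrite pair_dotE sumr_ge0// => i _; rewrite -expr2 sqr_ge0. Qed.

Lemma pair_dot_eq0 p : pair_dot p p = 0 -> p = 0.
Proof.
rewrite pair_dotE => /eqP; rewrite psumr_eq0 => [/allP p0|i _]; last first.
  by rewrite -expr2 sqr_ge0.
apply/colP => i; rewrite mxE; apply/eqP.
by have := p0 i (mem_index_enum i); rewrite mulf_eq0 orbb.
Qed.

Lemma simplex_pair_dot_le p Y Z : simplex p ->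
  (forall i, Y i 0 <= Z i 0) -> pair_dot p Y <= pair_dot p Z.
Proof.
by move=> [_ p0] YZ; rewrite !pair_dotE ler_sum// => i _; rewrite ler_wpM2l.
Qed.

Lemma simplex_pair_dot_const p c : simplex p -> pair_dot p (const_mx c) = c.
Proof.
move=> [p1 _]; rewrite pair_dotE; under eq_bigr do rewrite mxE.
by rewrite -mulr_suml p1 mul1r.
Qed.

End PairDot.

(** * Convexity with real weights, and subgradients of finite convex functions *)

Lemma convex_functionP (R : realType) (M : nat) (f : 'cV[R]_M -> R) :
  convex_function [set: 'cV[R]_M] f <->
  forall (Y Z : 'cV[R]_M) (t : R), 0 <= t -> t <= 1 ->
    f (t *: Y + (1 - t) *: Z) <= t * f Y + (1 - t) * f Z.
Proof.
split=> [cf Y Z t t0 t1|cf t Y Z _ _].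
  exact: (cf (Itv01 t0 t1) Y Z (in_setT _) (in_setT _)).
exact: (cf Y Z t%:num (ge0 t) (le1 t)).
Qed.

Lemma convex_setP (R : realType) (M : nat) (C : set 'cV[R]_M) :
  convex_set C -> forall (Y Z : 'cV[R]_M) (t : R), 0 <= t -> t <= 1 ->
    C Y -> C Z -> C (t *: Y + (1 - t) *: Z).
Proof.
move=> cC Y Z t t0 t1 CY CZ.
by have := cC Y Z (Itv01 t0 t1) (mem_set CY) (mem_set CZ); rewrite inE.
Qed.

(* Hahn-Banach step: [c] separates the difference quotients of [f - p] in the
   direction [-e], based at points of [V], from those in the direction [e]. *)
Lemma minorant_extension (R : realType) (M : nat) (f : 'cV[R]_M -> R)
    (V : set 'cV[R]_M) (p e : 'cV[R]_M) :
  convex_function [set: 'cV[R]_M] f -> V 0 -> convex_set V ->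
  (forall Y, V Y -> pair_dot p Y <= f Y) ->
  exists c, forall Y a, V Y -> pair_dot p Y + a * c <= f (Y + a *: e).
Proof.
move=> /convex_functionP cf V0 /convex_setP cV pf.
have slopes Y Z t s : V Y -> V Z -> 0 < t -> 0 < s ->
    (pair_dot p Y - f (Y - t *: e)) / t <= (f (Z + s *: e) - pair_dot p Z) / s.
  move=> VY VZ t0 s0; have st0 : 0 < s + t by rewrite addr_gt0.
  have st_neq0 : s + t != 0 by rewrite gt_eqF.
  (* This weight makes the displacements [- t *: e] and [s *: e] cancel, so the convex combination
     falls back into [V], where [p] minorizes [f]. *)
  set l := s / (s + t).
  have l0 : 0 <= l by rewrite divr_ge0// ltW.
  have lE : 1 - l = t / (s + t) by rewrite /l; field.
  have l1 : l <= 1 by rewrite -subr_ge0 lE divr_ge0// ltW.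
  have := cf (Y - t *: e) (Z + s *: e) l l0 l1.
  have -> : l *: (Y - t *: e) + (1 - l) *: (Z + s *: e)
      = l *: Y + (1 - l) *: Z.
    apply/colP => i; rewrite !mxE lE /l; field.
    by [].
  have := pf _ (cV Y Z l l0 l1 VY VZ); rewrite pair_dotDr !pair_dotZr => h1 h2.
  have {h1 h2} := le_trans h1 h2.
  have clear_den u w :
      (s + t) * (s / (s + t) * u + t / (s + t) * w) = s * u + t * w by field.
  rewrite lE -(ler_pM2l st0) !clear_den ler_pdivrMr// mulrAC ler_pdivlMr//.
  lra.
pose S := [set (pair_dot p Yt.1 - f (Yt.1 - Yt.2 *: e)) / Yt.2
           | Yt in [set Yt : 'cV[R]_M * R | V Yt.1 /\ 0 < Yt.2]].
have S0 : S !=set0 by eexists; exists (0, 1) => //; split=> //=; exact: ltr01.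
exists (sup S) => Y a VY.
(* A negative [a] uses that [sup S] bounds the backward slopes, a positive [a] that it lies below
   the forward slopes. *)
have [a0|a0|->] := ltrgtP a 0.
- have a0' : 0 < - a by rewrite oppr_gt0.
  suff : (pair_dot p Y - f (Y - (- a) *: e)) / (- a) <= sup S.
    by rewrite ler_pdivrMr// scaleNr opprK; lra.
  apply: ub_le_sup; last by exists (Y, - a).
  exists ((f (Y + 1 *: e) - pair_dot p Y) / 1) => _ [[Z t] [/= VZ t0] <-].
  exact: slopes.
- suff : sup S <= (f (Y + a *: e) - pair_dot p Y) / a.
    by rewrite ler_pdivlMr//; lra.
  by apply: ge_sup => // _ [[Z t] [/= VZ t0] <-]; exact: slopes.
- by rewrite mul0r scale0r !addr0; exact: pf.
Qed.

(** Induction on [k]: a minorant on the vectors supported on the first [k] coordinates is extended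
    in the direction of the next basis vector. *)
Lemma exists_linear_minorant (R : realType) (M : nat) (f : 'cV[R]_M -> R) :
  convex_function [set: 'cV[R]_M] f -> 0 <= f 0 ->
  exists p, forall Y, pair_dot p Y <= f Y.
Proof.
move=> cf f0.
pose V k := [set Y : 'cV[R]_M | forall i : 'I_M, (k <= i)%N -> Y i 0 = 0].
suff /(_ _ (leqnn M)) [p pf] :
    forall k, (k <= M)%N -> exists p, forall Y, V k Y -> pair_dot p Y <= f Y.
  by exists p => Y; apply: pf => i; rewrite leqNgt ltn_ord.
elim=> [_|k IHk kM].
  exists 0 => Y Y0; suff -> : Y = 0 by rewrite pair_dot0r.
  by apply/colP => i; rewrite Y0// mxE.
have [p pf] := IHk (ltnW kM).
pose ik := Ordinal kM; pose e : 'cV[R]_M := delta_mx ik 0.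
have edot Y : pair_dot e Y = Y ik 0.
  rewrite pair_dotE (bigD1 ik)//= big1 ?addr0; first by rewrite mxE !eqxx mul1r.
  by move=> i /negPf ik_i; rewrite mxE ik_i mul0r.
have cV : convex_set (V k).
  move=> Y Z t; rewrite !inE => VY VZ i ki.
  by rewrite !mxE VY// VZ// !mulr0 addr0.
have V0 : V k 0 by move=> i _; rewrite mxE.
have [c pc] := minorant_extension e cf V0 cV pf.
(* The new functional agrees with [p] on [V k], whose vectors are orthogonal to [e], and takes the
   value [c] at [e]. *)
exists (p + (c - pair_dot p e) *: e) => W VW.
pose a := W ik 0; pose Y := W - a *: e.
have WE : W = Y + a *: e by rewrite subrK.
have VY : V k Y.
  move=> i; rewrite leq_eqVlt => /orP[/eqP ki|/VW Wi].
    by rewrite (_ : i = ik) ?mxE ?eqxx ?mulr1 ?subrr//; exact/val_inj.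
  rewrite !mxE Wi; case: eqP => [i_ik|_]; last by rewrite mulr0 subr0.
  by rewrite /a -i_ik Wi mul0r subr0.
rewrite [X in f X]WE; apply: le_trans (pc Y a VY).
rewrite pair_dotC pair_dotDr pair_dotZr !(pair_dotC W) edot -/a.
by rewrite /Y pair_dotBr pair_dotZr; lra.
Qed.

(** A linear minorant of [f (V + Y) - f V], which vanishes at [Y = 0], is a subgradient of [f] at
    [V]. *)
Lemma exists_subgradient (R : realType) (M : nat) (f : 'cV[R]_M -> R) V :
  convex_function [set: 'cV[R]_M] f ->
  exists p, forall Y, f V + pair_dot p (Y - V) <= f Y.
Proof.
move=> /convex_functionP cf.
have cg : convex_function [set: 'cV[R]_M] (fun Y => f (V + Y) - f V).
  apply/convex_functionP => Y Z t t0 t1.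
  have := cf (V + Y) (V + Z) t t0 t1.
  rewrite (_ : t *: _ + _ = V + (t *: Y + (1 - t) *: Z)); first by move=> /= ?; lra.
  by apply/colP => i; rewrite !mxE; ring.
have [|p pf] := exists_linear_minorant cg; first by rewrite addr0 subrr.
by exists p => Y; have := pf (Y - V); rewrite (addrC V) subrK; lra.
Qed.

(** * Compactness of closed subsets of the simplex, and separation by the nearest point *)

Lemma trmx_continuous (T : topologicalType) (m n : nat) :
  continuous (@trmx T m n).
Proof.
move=> A B [P AP PB]; exists (fun i j => P j i).
  by move=> i j; have := AP j i; rewrite mxE.
by move=> N NP; apply: PB => i j; rewrite mxE; exact: NP.
Qed.

(** The simplex lies in the unit cube; the cube is compact as a product of segments in row vectors,
    then carried to columns by transposition. *)
Lemma closed_simplex_compact (R : realType) (M : nat) (C : set 'cV[R]_M) :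
  closed C -> C `<=` @simplex R M -> compact C.
Proof.
move=> Cclosed CS.
pose I01 := [set v : 'rV[R]_M | forall i, `[0, 1]%classic (v ord0 i)].
have cI01 : compact I01.
  apply: (@rV_compact R M (fun=> `[0, 1]%classic)) => _.
  exact: segment_compact.
have trc : {within I01, continuous (@trmx R 1 M)}.
  by apply: continuous_subspaceT; exact: trmx_continuous.
have cube : compact (trmx @` I01) := continuous_compact trc cI01.
apply: (subclosed_compact Cclosed cube) => p /CS[p1 p0].
exists p^T; last by rewrite trmxK.
move=> i; rewrite /= mxE in_itv/= p0 /= -p1 (bigD1 i)//= lerDl.
by rewrite sumr_ge0.
Qed.

(** Here [s] is at most the support function of [C]. If [q] is the point of [C] nearest to [p] and
    [Y = p - q], then [q] maximizes the pairing with [Y] over [C], so [p.Y <= s Y <= q.Y], that is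
    [Y.Y <= 0]. *)
Lemma support_dominated_mem (R : realType) (M : nat) (C : set 'cV[R]_M)
    (s : 'cV[R]_M -> R) (p : 'cV[R]_M) :
  C !=set0 -> closed C -> convex_set C -> C `<=` @simplex R M ->
  (forall Y c, (forall q, C q -> pair_dot q Y <= c) -> s Y <= c) ->
  (forall Y, pair_dot p Y <= s Y) -> C p.
Proof.
move=> C0 Cclosed /convex_setP Cconvex CS sC ps.
pose d q := pair_dot (q - p) (q - p).
have dcont : continuous d.
  rewrite /d; under eq_fun do rewrite pair_dotE.
  apply: continuous_big => [|i _]; first exact: add_continuous.
  have ci : continuous (fun q : 'cV[R]_M => (q - p) i 0).
    under eq_fun do rewrite !mxE.
    move=> q; apply: (@continuousB R R _ (fun q : 'cV[R]_M => q i 0)).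
      exact: (@coord_continuous R M 1 i 0 q).
    exact: cst_continuous.
  by move=> q; apply: continuousM; exact: ci.
have Ccompact := closed_simplex_compact Cclosed CS.
have [|q /set_mem Cq qmin] := compact_EVT_min C0 Ccompact (f := d).
  exact: continuous_subspaceT.
set Y := p - q.
(* No point of the segment from [q] to [r] is closer to [p] than [q]. *)
have variation r : C r -> pair_dot r Y <= pair_dot q Y.
  move=> Cr; rewrite -subr_ge0 -pair_dotBl leNgt; apply/negP => neg.
  set b := pair_dot (r - q) (r - q).
  set u := pair_dot (r - q) Y.
  have u0 : 0 < u.
    by rewrite /u -opprB pair_dotC -scaleN1r pair_dotZr pair_dotC; lra.
  have b0 : 0 <= b by exact: pair_dot_ge0.
  have ub0 : 0 < u + b by lra.
  (* A step [t] towards [r] changes the squared distance by [- 2tu + t^2 b]. Since [tb = u - tu] for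
     this [t], the change is [- tu - t^2 u < 0], and [t <= 1] keeps the point in [C]. *)
  set t := u / (u + b).
  have t0 : 0 <= t by rewrite divr_ge0// ltW.
  have t1 : t <= 1 by rewrite ler_pdivrMr// mul1r lerDl.
  have := qmin _ (mem_set (Cconvex r q t t0 t1 Cr Cq)).
  have -> : d (t *: r + (1 - t) *: q) = d q - 2 * t * u + t ^+ 2 * b.
    rewrite /d /u /b /Y !pair_dotE !mulr_sumr -sumrB -big_split/=.
    by apply: eq_bigr => i _; rewrite !mxE; ring.
  have -> : t ^+ 2 * b = t * (u - t * u) by rewrite /t; field; rewrite gt_eqF.
  have tu : 0 < t * u by rewrite mulr_gt0// divr_gt0.
  have : 0 <= t * (t * u) by rewrite mulr_ge0// ltW.
  lra.
have : pair_dot p Y <= pair_dot q Y by apply: le_trans (ps Y) (sC _ _ variation).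
rewrite -subr_le0 -pair_dotBl -/Y => Y0.
suff /eqP : Y = 0 by rewrite subr_eq0 => /eqP ->.
by apply: pair_dot_eq0; apply/eqP; rewrite eq_le Y0 pair_dot_ge0.
Qed.

(** * Finite extended-real suprema, and risk functions given by penalized suprema *)

Lemma EFin_eq_ereal_sup (R : realType) (I : Type) (C : set I) (g : I -> R)
    (r : R) :
  r%:E = ereal_sup [set (g p)%:E | p in C] ->
  (forall p, C p -> g p <= r) /\
  (forall c, (forall p, C p -> g p <= c) -> r <= c).
Proof.
move=> rE; split=> [p Cp|c gc]; rewrite -lee_fin rE.
  by apply: ereal_sup_ubound; exists p.
by apply: ge_ereal_sup => _ [p Cp <-]; rewrite lee_fin; exact: gc.
Qed.

Lemma sup_norm_leP (R : realType) (M : nat) (f : 'cV[R]_M -> R) (eps : R) :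
  (sup_norm f <= eps%:E)%E <-> forall Z, `|f Z| <= eps.
Proof.
split=> [fe Z|fe]; last by apply: ge_ereal_sup => _ [Z _ <-]; rewrite lee_fin.
by rewrite -lee_fin; apply: le_trans fe; apply: ereal_sup_ubound; exists Z.
Qed.

(** For [p] in the simplex, [p.V - a p] is monotone and affine in [V] and increases by [c] when [V]
    does; these properties pass to the supremum over [p]. *)
Lemma penalized_sup_risk_function (R : realType) (M : nat) (C : set 'cV[R]_M)
    (a : 'cV[R]_M -> R) (rho : 'cV[R]_M -> R) :
  C `<=` @simplex R M ->
  (forall V, (rho V)%:E = ereal_sup [set (pair_dot p V - a p)%:E | p in C]) ->
  rho 0 = 0 -> risk_function rho.
Proof.
move=> CS /(_ _)/EFin_eq_ereal_sup rhoP rho0.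
have ub V p : C p -> pair_dot p V - a p <= rho V by have [+ _] := rhoP V; apply.
have lub V c : (forall p, C p -> pair_dot p V - a p <= c) -> rho V <= c.
  by have [_ +] := rhoP V; apply.
have translate V c : rho (V + const_mx c) <= rho V + c.
  apply: lub => p Cp; have := ub V p Cp.
  by rewrite pair_dotDr simplex_pair_dot_const; [lra|exact: CS].
split=> //.
- move=> Y Z YZ; apply: lub => p Cp; apply: le_trans (ub Z p Cp).
  by rewrite lerD2r; apply: simplex_pair_dot_le => //; exact: CS.
- apply/convex_functionP => Y Z t t0 t1; apply: lub => p Cp.
  rewrite pair_dotDr !pair_dotZr.
  have hY := ler_wpM2l t0 (ub Y p Cp).
  have t1' : 0 <= 1 - t by rewrite subr_ge0.
  have hZ := ler_wpM2l t1' (ub Z p Cp).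
  lra.
- move=> V c; apply/eqP; rewrite eq_le translate/=.
  (* The reverse inequality is the same bound applied to the opposite shift. *)
  have := translate (V + const_mx c) (- c).
  rewrite -addrA (_ : const_mx c + const_mx (- c) = 0) ?addr0; first by lra.
  by apply/colP => i; rewrite !mxE subrr.
Qed.

(* [f (t Y) / t] tends to [s Y] as [t] tends to +oo, so [p.Y <= s Y]. *)
Lemma subgradient_mem_support (R : realType) (M : nat) (C : set 'cV[R]_M)
    (s f : 'cV[R]_M -> R) (eps : R) (p V : 'cV[R]_M) :
  coherent s -> support_set s C -> (forall Y, `|f Y - s Y| <= eps) ->
  (forall Y, f V + pair_dot p (Y - V) <= f Y) -> C p.
Proof.
move=> [_ sZ] [C0 Cclosed Cconvex CS sE] fs pf.
apply: (support_dominated_mem C0 Cclosed Cconvex CS (s := s)) => Y.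
  by move=> c qc; have [_] := EFin_eq_ereal_sup (sE Y); apply.
rewrite leNgt -subr_gt0; apply/negP; set d := pair_dot p Y - s Y => d0.
(* The subgradient inequality at [t *: Y], with [f <= s + eps] and homogeneity of [s], gives
   [t * d <= k] for every [t >= 0]; [t = (k + 1) / d] then contradicts [d > 0]. *)
pose k := eps + pair_dot p V - f V.
have bound t : 0 <= t -> t * d <= k.
  move=> t0; have := pf (t *: Y); rewrite pair_dotBr pair_dotZr.
  have := fs (t *: Y); rewrite sZ// ler_norml => /andP[_].
  by rewrite /k /d; lra.
have k0 : 0 <= k by have := bound 0 (lexx _); rewrite mul0r.
have : (k + 1) / d * d <= k by apply: bound; rewrite divr_ge0 ?ltW//; lra.
by rewrite divfK ?gt_eqF//; lra.
Qed.

(** * The function [rho_delta] whose parameters are the values of [f] at the data points *)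

Section RhoDelta.
Variables (R : realType) (M : nat) (J : finType) (j0 : J).
Variables (Xs : J -> 'cV[R]_M) (C : set 'cV[R]_M) (f : 'cV[R]_M -> R).
Hypothesis Xs0 : Xs j0 = 0.
Hypothesis f0 : f 0 = 0.

(** The convex conjugate of [f] with its supremum restricted to the points [Xs j]. *)
Let conj_max (p : 'cV[R]_M) : \bar R :=
  \big[maxe/-oo%E]_(j : J) (pair_dot p (Xs j) - f (Xs j))%:E.

Let penalty p := fine (conj_max p).

Let conj_max_ub p j : ((pair_dot p (Xs j) - f (Xs j))%:E <= conj_max p)%E.
Proof. exact: le_bigmax. Qed.

(** The index [j0] keeps the maximum above [-oo], and finitely many real terms keep it below
    [+oo]. *)
Let penaltyE p : (penalty p)%:E = conj_max p.
Proof.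
apply: fineK; rewrite fin_numElt; apply/andP; split.
  exact: lt_le_trans (ltNyr _) (conj_max_ub p j0).
by apply/bigmax_ltP; split=> // j _; rewrite ltry.
Qed.

Let rho_deltaE V : rho_delta Xs C (f \o Xs) V =
  ereal_sup [set (pair_dot p V - penalty p)%:E | p in C].
Proof.
rewrite /rho_delta; congr ereal_sup.
by apply: eq_imagel => p _; rewrite EFinB penaltyE.
Qed.

Let penalty_ub p j : pair_dot p (Xs j) - f (Xs j) <= penalty p.
Proof. by rewrite -lee_fin penaltyE conj_max_ub. Qed.

Lemma rho_delta_risk_function (s : 'cV[R]_M -> R) (eps : R) :
  coherent s -> support_set s C -> convex_function [set: 'cV[R]_M] f ->
  (forall Y, `|f Y - s Y| <= eps) ->
  exists rho, [/\ forall V, (rho V)%:E = rho_delta Xs C (f \o Xs) V,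
    risk_function rho, forall V, f V <= rho V <= s V
    & forall j, rho (Xs j) = f (Xs j)].
Proof.
move=> s_coh sC cf fs; have [_ _ _ CS sE] := sC.
have ge_f V : ((f V)%:E <= rho_delta Xs C (f \o Xs) V)%E.
  have [p pf] := exists_subgradient V cf.
  have Cp := subgradient_mem_support s_coh sC fs pf.
  rewrite rho_deltaE; apply: (@le_trans _ _ (pair_dot p V - penalty p)%:E).
    2: by apply: ereal_sup_ubound; exists p.
  (* The goal becomes [penalty p <= p.V - f V]; each term of the maximum obeys this bound by the
     subgradient inequality at [Xs j]. *)
  rewrite lee_fin lerBrDr addrC -lerBrDr -lee_fin penaltyE.
  apply/bigmax_leP; split=> [|j _]; first by rewrite leNye.
  by rewrite lee_fin; have := pf (Xs j); rewrite pair_dotBr; lra.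
have le_s V : (rho_delta Xs C (f \o Xs) V <= (s V)%:E)%E.
  rewrite rho_deltaE; apply: ge_ereal_sup => _ [p Cp <-]; rewrite lee_fin.
  have [/(_ p Cp) + _] := EFin_eq_ereal_sup (sE V).
  (* The term of index [j0] is zero, so the penalty is nonnegative. *)
  by have := penalty_ub p j0; rewrite Xs0 f0 pair_dot0r; lra.
pose rho V := fine (rho_delta Xs C (f \o Xs) V).
have rhoE V : (rho V)%:E = rho_delta Xs C (f \o Xs) V.
  apply: fineK; rewrite fin_numElt.
  by rewrite (lt_le_trans (ltNyr _) (ge_f V)) (le_lt_trans (le_s V) (ltry _)).
have rho_ge V : f V <= rho V by rewrite -lee_fin rhoE.
have rhoX j : rho (Xs j) = f (Xs j).
  apply/eqP; rewrite eq_le rho_ge andbT -lee_fin rhoE rho_deltaE.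
  apply: ge_ereal_sup => _ [p Cp <-]; rewrite lee_fin.
  by have := penalty_ub p j; lra.
exists rho; split=> //; last by move=> V; rewrite rho_ge -lee_fin rhoE le_s.
apply: (penalized_sup_risk_function CS) => [V|]; first by rewrite rhoE rho_deltaE.
by rewrite -Xs0 rhoX Xs0.
Qed.

End RhoDelta.

(** * Optimality of the majorant in the inverse problem *)

Theorem proposition1 (R : realType) (M n : nat) (T K : finType)
    (X : T -> set 'cV[R]_n) (Z : T -> 'cV[R]_n -> 'cV[R]_M)
    (x : T -> 'cV[R]_n) (L U : K -> 'cV[R]_M)
    (rhot : 'cV[R]_M -> R) (C : set 'cV[R]_M)
    (X_convex : forall t, convex_set (X t))
    (Z_convex : forall t i, convex_function (X t) (fun y => Z t y i 0))
    (x_in_X : forall t, X t (x t))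
    (rhot_coherent : coherent rhot)
    (rhot_support : support_set rhot C)
    (optimal_nonempty : exists rho, inverse_optimal rhot X Z x L U rho) :
  let Xs := data_losses (fun t => Z t (x t)) L U in
  (exists rho, rho_delta_family Xs C rho /\ inverse_optimal rhot X Z x L U rho)
  /\
  (forall rho0, inverse_optimal rhot X Z x L U rho0 ->
     exists rho,
       [/\ rho_delta_family Xs C rho,
           forall V, (rho V)%:E = rho_delta Xs C (fun j => rho0 (Xs j)) V,
           inverse_optimal rhot X Z x L U rho
         & forall V, rho0 V <= rho V]).

Proof.
move=> Xs.
suff majorant rho0 : inverse_optimal rhot X Z x L U rho0 ->
    exists rho, [/\ rho_delta_family Xs C rho,
      forall V, (rho V)%:E = rho_delta Xs C (fun j => rho0 (Xs j)) V,
      inverse_optimal rhot X Z x L U rho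
      & forall V, rho0 V <= rho V].
  split=> //; have [rho0 /majorant[rho [rhoC _ rho_opt _]]] := optimal_nonempty.
  by exists rho.
move=> [eps [[rho0_risk /sup_norm_leP rho0_eps rho0W rho0LU] eps_min]].
have [rho00 _ rho0_convex _] := rho0_risk.
have [rho [rhoE rho_risk rho_bounds rhoX]] := rho_delta_risk_function
  (erefl : Xs None = 0) rho00 rhot_coherent rhot_support rho0_convex rho0_eps.
have rho0_le V : rho0 V <= rho V by have /andP[] := rho_bounds V.
exists rho; split=> //; first by exists (rho0 \o Xs).
(* Minimality of [eps] does not involve the chosen function, so feasibility of [rho] with the same
   [eps] suffices. *)
exists eps; split=> //; split=> //.
(* From [rho0 <= rho <= rhot], the difference [rho - rhot] is at least [- eps] and at most
   [0 <= eps]. *)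
- apply/sup_norm_leP => V; have := rho0_eps V.
  have := rho_bounds V; have := le_trans (normr_ge0 _) (rho0_eps V).
  by rewrite !ler_norml => eps0 /andP[? ?] /andP[? ?]; apply/andP; split; lra.
(* Equality with [rho0] at the observed loss and domination of [rho0] at [W] preserve the
   inequality. *)
- move=> t W /(rho0W t W) WtW; rewrite (rhoX (Some (inl t))).
  exact: le_trans WtW (rho0_le W).
- move=> k; rewrite (rhoX (Some (inr (inl k)))) (rhoX (Some (inr (inr k)))); exact: rho0LU.
Qed.
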